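(* Let $\Omega$ be an open convex subset of $\mathbb{R}^n$ and let $\breve{F}:\Omega\to K(\mathbb{R})$ be differentiable on $\Omega$ (in the sense of the Markov difference). Then for any $u,v\in\Omega$, $$\breve{F}(v)\ominus_M\breve{F}(u)\subset\bigcup_{c\in L.S\{u,v\}}\ \sum_{i=1}^n (v_i-u_i)\odot\frac{\partial\breve{F}(c)}{\partial x_i},$$ where $L.S\{u,v\}=\{u+t(v-u):t\in[0,1]\}$ is the line segment joining $u$ and $v$, the sum is interval (Minkowski) addition $\oplus$, and $\frac{\partial \breve F(c)}{\partial x_i}$ is the partial derivative of $\breve F$ at $c$ with respect to the $i$-th variable.
   Context: $K(\mathbb{R})$ is the set of compact intervals $\breve\alpha=[\underline\alpha,\overline\alpha]$, $\underline\alpha\le\overline\alpha$; real numbers are identified with degenerate intervals and $\breve 0=[0,0]$. $\breve\alpha\oplus\breve\beta=[\underline\alpha+\underline\beta,\overline\alpha+\overline\beta]$; for a real $r$, $r\odot\breve\alpha=\{ra:a\in\breve\alpha\}$ (division by a real $h\neq 0$ means $\frac1h\odot$). The Markov difference is $$\breve\alpha\ominus_M\breve\beta=\left[\min\{\underline\alpha-\underline\beta,\overline\alpha-\overline\beta\},\max\{\underline\alpha-\underline\beta,\overline\alpha-\overline\beta\}\right].$$ Limits and continuity in $K(\mathbb{R})$ are with respect to the metric $d(\breve\alpha,\breve\beta)=\max\{|\underline\alpha-\underline\beta|,|\overline\alpha-\overline\beta|\}$. For an interval-valued function $\breve F$ on an open subset of $\mathbb{R}^n$, the partial derivative at $x$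 with respect to the $i$-th variable is $$\frac{\partial\breve F(x)}{\partial x_i}=\lim_{h_i\to0}\frac{\breve F(x_1,\dots,x_{i-1},x_i+h_i,x_{i+1},\dots,x_n)\ominus_M\breve F(x)}{h_i}\in K(\mathbb{R}),$$ if this limit exists. $\breve F$ is differentiable at $x_0$ if all partial derivatives $\frac{\partial\breve F(x_0)}{\partial x_i}$ exist and there is an interval-valued function $\breve E_{x_0}$ with $\lim_{\|h\|\to0}\breve E_{x_0}(h)=\breve 0$ such that, for some $\delta>0$ and all $h\in\mathbb{R}^n$ with $\|h\|<\delta$, $$\breve F(x_0+h)\ominus_M\breve F(x_0)=\left(\sum_{i=1}^n h_i\odot\frac{\partial\breve F(x_0)}{\partial x_i}\right)\oplus\|h\|\odot\breve E_{x_0}(h),$$ the sum being with respect to $\oplus$. $\breve F$ is differentiable on a set if it is differentiable at each of its points. The symbol $\subset$ denotes (not necessarily strict) inclusion of subsets of $\mathbb{R}$. *)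

(* Defs.v *)
From HB Require Import structures.
From mathcomp Require Import all_boot all_order all_algebra.
From mathcomp Require Import all_classical all_reals all_analysis.

Set Implicit Arguments.
Unset Strict Implicit.
Unset Printing Implicit Defensive.

Import Order.TTheory GRing.Theory Num.Theory.
Import numFieldNormedType.Exports.

Local Open Scope classical_set_scope.
Local Open Scope ring_scope.

Reserved Notation "A '\ominus_M' B" (at level 50, left associativity).
Reserved Notation "r '\odot' A" (at level 40, left associativity).

(* K(R): the nonempty compact intervals of R *)
Record cinterval (R : realType) := CInterval {
  lo : R;
  hi : R;
  lo_le_hi : lo <= hi
}.

Section cinterval_theory.
Context {R : realType}.
Implicit Types (A B C : cinterval R) (r : R).

Definition ciset A : set R := `[lo A, hi A].

Lemma cinterval_eq A B : lo A = lo B -> hi A = hi B -> A = B.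
Proof.
case: A B => [a b ab] [c d cd] /= ac bd.
by case: c / ac cd => cd; case: d / bd cd => cd; congr CInterval.
Qed.

Fact ci_zero_subproof : (0 : R) <= 0. Proof. exact: lexx. Qed.
Definition ci_zero : cinterval R := CInterval ci_zero_subproof.

Fact ci_add_subproof A B : lo A + lo B <= hi A + hi B.
Proof. by rewrite lerD ?lo_le_hi. Qed.
Definition ci_add A B : cinterval R := CInterval (ci_add_subproof A B).

Fact ci_min_max_subproof (x y : R) : Num.min x y <= Num.max x y.
Proof. by rewrite ge_min le_max lexx. Qed.

Definition ci_scale r A : cinterval R :=
  CInterval (ci_min_max_subproof (r * lo A) (r * hi A)).

Definition ci_Markov_diff A B : cinterval R :=
  CInterval (ci_min_max_subproof (lo A - lo B) (hi A - hi B)).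

Definition ci_dist A B : R := Num.max `|lo A - lo B| `|hi A - hi B|.

(* r \odot A is defined by its endpoints; it is indeed {r * a : a \in A}. *)
Lemma ciset_scale r A : ciset (ci_scale r A) = [set r * a | a in ciset A].
Proof.
have AB := lo_le_hi A.
apply/seteqP; split => x /=.
- rewrite /ciset /= in_itv /=; case: (ltrgtP r 0) => [r0|r0|->].
  + have le : r * hi A <= r * lo A by rewrite ler_nM2l.
    rewrite (min_idPr le) (max_idPl le) => /andP[x1 x2].
    exists (r^-1 * x); last by rewrite mulrA mulfV ?mul1r// lt_eqF.
    rewrite /= in_itv /=; apply/andP; split.
      by rewrite -(ler_nM2l r0) mulrA mulfV ?mul1r// lt_eqF.
    by rewrite -(ler_nM2l r0) mulrA mulfV ?mul1r// lt_eqF.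
  + have le : r * lo A <= r * hi A by rewrite ler_pM2l.
    rewrite (min_idPl le) (max_idPr le) => /andP[x1 x2].
    exists (r^-1 * x); last by rewrite mulrA mulfV ?mul1r// gt_eqF.
    rewrite /= in_itv /=; apply/andP; split.
      by rewrite -(ler_pM2l r0) mulrA mulfV ?mul1r// gt_eqF.
    by rewrite -(ler_pM2l r0) mulrA mulfV ?mul1r// gt_eqF.
  + rewrite !mul0r minxx maxxx => /le_anti <-.
    by exists (lo A); rewrite ?mul0r//= in_itv /= lexx.
- case=> a; rewrite /ciset /= !in_itv /= => /andP[a1 a2] <-.
  rewrite ge_min le_max; have [r0|r0] := leP 0 r.
    by rewrite (ler_wpM2l r0 a1) (ler_wpM2l r0 a2) ?orbT.
  by rewrite (ler_wnM2l (ltW r0) a1) (ler_wnM2l (ltW r0) a2) ?orbT.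
Qed.

Fact ci_addA : associative ci_add.
Proof. by move=> A B C; apply: cinterval_eq; rewrite /= addrA. Qed.

Fact ci_addC : commutative ci_add.
Proof. by move=> A B; apply: cinterval_eq; rewrite /= addrC. Qed.

Fact ci_add0 : left_id ci_zero ci_add.
Proof. by move=> A; apply: cinterval_eq; rewrite /= add0r. Qed.

Fact ci_distxx A : ci_dist A A = 0.
Proof. by rewrite /ci_dist !subrr normr0 maxxx. Qed.

Fact ci_dist_eq0 A B : ci_dist A B = 0 -> A = B.
Proof.
move=> AB0; have : ci_dist A B <= 0 by rewrite AB0.
rewrite /ci_dist ge_max !normr_le0 !subr_eq0 => /andP[/eqP ? /eqP ?].
exact: cinterval_eq.
Qed.

Fact ci_dist_sym A B : ci_dist A B = ci_dist B A.
Proof. by rewrite /ci_dist (distrC (lo A)) (distrC (hi A)). Qed.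

Fact ci_dist_triangle B A C : ci_dist A C <= ci_dist A B + ci_dist B C.
Proof.
rewrite /ci_dist ge_max; apply/andP; split.
- by apply: (le_trans (ler_distD (lo B) _ _)); rewrite lerD// le_max lexx.
- by apply: (le_trans (ler_distD (hi B) _ _)); rewrite lerD// le_max lexx orbT.
Qed.

End cinterval_theory.

HB.instance Definition _ (R : realType) := gen_eqMixin (cinterval R).
HB.instance Definition _ (R : realType) := gen_choiceMixin (cinterval R).
HB.instance Definition _ (R : realType) :=
  isPointed.Build (cinterval R) ci_zero.
(* the \oplus of intervals is the addition of this (cancellative, but not
   invertible) commutative monoid, so that \sum is the Minkowski sum *)
HB.instance Definition _ (R : realType) :=
  GRing.isNmodule.Build (cinterval R) ci_addA ci_addC ci_add0.
HB.instance Definition _ (R : realType) :=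
  isMetric.Build R (cinterval R)
    ci_distxx ci_dist_eq0 ci_dist_sym ci_dist_triangle.

Notation "A '\ominus_M' B" := (ci_Markov_diff A B) : ring_scope.
Notation "r '\odot' A" := (ci_scale r A) : ring_scope.

Section Markov_differentiability.
Context {R : realType} {n : nat}.
Implicit Types (F : 'rV[R]_n -> cinterval R) (x u v : 'rV[R]_n).

Definition enorm x : R := Num.sqrt (\sum_(i < n) x 0 i ^+ 2).

Definition line_seg u v : set 'rV[R]_n :=
  [set u + t *: (v - u) | t in `[0, 1]].

(* A function on an open set Omega is represented by an arbitrary extension F
   to the whole space: at a point of Omega, the notions below only depend on
   the values of F near that point. *)
Definition Mquotient F x (i : 'I_n) (h : R) : cinterval R :=
  h^-1 \odot (F (x + h *: delta_mx 0 i) \ominus_M F x).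

Definition Mpartial F x (i : 'I_n) : cinterval R :=
  lim (Mquotient F x i @ 0^').

Definition Mdifferentiable_at F x : Prop :=
  (forall i, cvg (Mquotient F x i @ 0^')) /\
  exists E : 'rV[R]_n -> cinterval R,
    E @ (0 : 'rV[R]_n)^' --> (0 : cinterval R) /\
    exists2 delta : R, 0 < delta & forall h, enorm h < delta ->
      F (x + h) \ominus_M F x =
        (\sum_(i < n) h 0 i \odot Mpartial F x i) + enorm h \odot E h.

Definition Mdifferentiable_on (Omega : set 'rV[R]_n) F : Prop :=
  forall x, Omega x -> Mdifferentiable_at F x.

End Markov_differentiability.

(* Main.v *)
Require Import Defs.
From HB Require Import structures.
From mathcomp Require Import all_boot all_order all_algebra.
From mathcomp Require Import all_classical all_reals all_analysis.
From mathcomp Require Import ring lra.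

Import Order.TTheory GRing.Theory Num.Theory.
Import numFieldNormedType.Exports.

Local Open Scope classical_set_scope.
Local Open Scope ring_scope.

(* Restrict F to the segment, G t = F (u + t (v - u)). Differentiability says
   that the interval G (t + s) \ominus_M G t is s \odot D t up to o(s), where
   D t = \sum_i (v_i - u_i) \odot dF/dx_i. The endpoints of G need not be
   differentiable, since the increments of lo G and hi G may trade places; but
   any convex combination of them has its difference quotients asymptotically
   inside D t. A point y of G 1 \ominus_M G 0 is the increment over [0, 1] of
   such a combination phi, and Rolle's argument applies: phi t - y t takes the
   same value at 0 and 1, and at an interior extremum t the one-sided quotients
   have opposite signs, so that y lies in D t. *)

(** * Scaling, sums and distances of intervals *)

Section interval_algebra.
Context {R : realType}.
Implicit Types (A B : cinterval R) (r s : R).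

Lemma lo_scale_ge0 r A : 0 <= r -> lo (r \odot A) = r * lo A.
Proof. by move=> r0; apply/min_idPl; rewrite ler_wpM2l// lo_le_hi. Qed.

Lemma hi_scale_ge0 r A : 0 <= r -> hi (r \odot A) = r * hi A.
Proof. by move=> r0; apply/max_idPr; rewrite ler_wpM2l// lo_le_hi. Qed.

Lemma lo_scale_le0 r A : r <= 0 -> lo (r \odot A) = r * hi A.
Proof. by move=> r0; apply/min_idPr; rewrite ler_wnM2l// lo_le_hi. Qed.

Lemma hi_scale_le0 r A : r <= 0 -> hi (r \odot A) = r * lo A.
Proof. by move=> r0; apply/max_idPl; rewrite ler_wnM2l// lo_le_hi. Qed.

Lemma ci_scale0r A : 0 \odot A = 0.
Proof. by apply: cinterval_eq; rewrite /= !mul0r ?minxx ?maxxx. Qed.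

Lemma ci_scaler0 r : r \odot 0 = 0 :> cinterval R.
Proof. by apply: cinterval_eq; rewrite /= !mulr0 ?minxx ?maxxx. Qed.

(** A negative [r] exchanges the endpoints of [A] and of [B] simultaneously, so for a fixed scalar
    the endpoints still add up. *)
Lemma ci_scaleDr r A B : r \odot (A + B) = r \odot A + r \odot B.
Proof.
have loD C C' : lo (C + C') = lo C + lo C' :> R by [].
have hiD C C' : hi (C + C') = hi C + hi C' :> R by [].
have [r0|/ltW r0] := leP 0 r; apply: cinterval_eq.
- by rewrite loD !lo_scale_ge0// loD mulrDr.
- by rewrite hiD !hi_scale_ge0// hiD mulrDr.
- by rewrite loD !lo_scale_le0// hiD mulrDr.
- by rewrite hiD !hi_scale_le0// loD mulrDr.
Qed.

Lemma ci_scaleA r s A : r \odot (s \odot A) = (r * s) \odot A.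
Proof.
apply: cinterval_eq; rewrite [RHS]/= -!mulrA.
  have [r0|/ltW r0] := leP 0 r.
    by rewrite lo_scale_ge0//= minr_pMr.
  by rewrite lo_scale_le0//= maxr_nMr.
have [r0|/ltW r0] := leP 0 r.
  by rewrite hi_scale_ge0//= maxr_pMr.
by rewrite hi_scale_le0//= minr_nMr.
Qed.

Lemma ci_scale_sumr (I : finType) r (A : I -> cinterval R) :
  r \odot (\sum_i A i) = \sum_i r \odot A i.
Proof. exact: (big_morph _ (ci_scaleDr r) (ci_scaler0 r)). Qed.

Lemma ci_distDl A B : ci_dist (A + B) A = ci_dist B 0.
Proof. by rewrite /ci_dist /= ![_ + _ - _]addrAC !subrr !add0r !subr0. Qed.

Lemma ci_dist_scale0 r A : 0 <= r -> ci_dist (r \odot A) 0 = r * ci_dist A 0.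
Proof.
move=> r0; rewrite /ci_dist lo_scale_ge0// hi_scale_ge0// !subr0 !normrM.
by rewrite (ger0_norm r0) maxr_pMr.
Qed.

Lemma scale_endpoints_le r A :
  - (`|r| * (`|lo A| + `|hi A|)) <= lo (r \odot A) /\
  hi (r \odot A) <= `|r| * (`|lo A| + `|hi A|).
Proof.
have rl : `|r * lo A| <= `|r| * (`|lo A| + `|hi A|).
  by rewrite normrM ler_wpM2l// lerDl.
have rh : `|r * hi A| <= `|r| * (`|lo A| + `|hi A|).
  by rewrite normrM ler_wpM2l// lerDr.
move: rl rh; rewrite !ler_norml => /andP[rl1 rl2] /andP[rh1 rh2].
by rewrite /= le_min ge_max rl1 rl2 rh1 rh2.
Qed.

Lemma cinterval_ballE A (e : R) : ball A e = [set B | ci_dist A B < e].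
Proof. by []. Qed.

End interval_algebra.

(** * A mean value inclusion for interval functions of one real variable *)

Section mean_value.
Context {R : realType}.
Variables G D : R -> cinterval R.

Hypothesis G_diff : forall t, t \in `[0, 1] -> forall e : R, 0 < e ->
  \forall s \near 0,
    ci_dist (G (t + s) \ominus_M G t) (s \odot D t) <= e * `|s|.

Let phi (l t : R) := l * lo (G t) + (1 - l) * hi (G t).

(** The increment of [phi l] is a convex combination of the increments of [lo G] and [hi G], so it
    lies between their minimum and maximum. These are the endpoints of the Markov difference,
    whichever increment is the larger. *)
Let phi_diff (l t : R) : 0 <= l <= 1 -> t \in `[0, 1] -> forall e : R, 0 < e ->
  \forall s \near 0,
    lo (s \odot D t) - e * `|s| <= phi l (t + s) - phi l t
      <= hi (s \odot D t) + e * `|s|.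
Proof.
move=> /andP[l0 l1] t01 e e0; near=> s.
have : ci_dist (G (t + s) \ominus_M G t) (s \odot D t) <= e * `|s|.
  by near: s; exact: G_diff.
rewrite /ci_dist [lo (_ \ominus_M _)]/= [hi (_ \ominus_M _)]/= ge_max.
rewrite !ler_norml.
move=> /andP[/andP[lb _] /andP[_ ub]].
set f := lo (G (t + s)) - lo (G t) in lb ub.
set g := hi (G (t + s)) - hi (G t) in lb ub.
have -> : phi l (t + s) - phi l t = l * f + (1 - l) * g.
  by rewrite /phi /f /g; lra.
move: lb ub; set mn := Num.min f g; set mx := Num.max f g => lb ub.
have mnf : mn <= f by rewrite ge_min lexx.
have mng : mn <= g by rewrite ge_min lexx orbT.
have mxf : f <= mx by rewrite le_max lexx.
have mxg : g <= mx by rewrite le_max lexx orbT.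
by apply/andP; split; nra.
Unshelve. all: by end_near. Qed.

Let phi_cont (l : R) : 0 <= l <= 1 -> {in `[0, 1], continuous (phi l)}.
Proof.
move=> l01 t t01; apply/cvgrPdist_le => e e0.
apply: ((nbhs0P (fun r => `|phi l t - phi l r| <= e) t).2).
(* The summand 1 absorbs the error of [phi_diff] taken with [e = 1]; the rest bounds the endpoints
   of [s \odot D t] per unit of [|s|]. *)
pose C := 1 + (`|lo (D t)| + `|hi (D t)|).
have C0 : 0 < C by rewrite ltr_pwDl// addr_ge0.
near=> s.
have /andP[lb ub] : lo (s \odot D t) - 1 * `|s| <= phi l (t + s) - phi l t
    <= hi (s \odot D t) + 1 * `|s|.
  by near: s; exact: phi_diff.
have [lD hD] := scale_endpoints_le s (D t).
have sC : `|s| * C <= e.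
  by rewrite -ler_pdivlMr//; near: s; exact: (@nbhs0_le R R _ (divr_gt0 e0 C0)).
rewrite mulrDr mulr1 in sC.
by rewrite distrC ler_norml; apply/andP; split; lra.
Unshelve. all: by end_near. Qed.

(* [k] is [1] at a maximum of [phi l r - y * r] and [-1] at a minimum. *)
Let interior_extremum (l y k t : R) :
  0 <= l <= 1 -> k ^+ 2 = 1 -> t \in `]0, 1[ ->
  {in `[0, 1], forall r, k * (phi l r - y * r) <= k * (phi l t - y * t)} ->
  lo (D t) <= y <= hi (D t).
Proof.
move=> l01 k2 t01 kt.
have t01' : t \in `[0, 1] by exact: subset_itv_oo_cc.
suff H e : 0 < e -> lo (D t) - e <= y <= hi (D t) + e.
  by apply/andP; split; apply/ler_addgt0Pr => e /H /andP[]; lra.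
move=> e0.
(* One small positive [s] serves both sides: [P1] is used at [t + s] and [P2] at [t - s], where the
   negative factor exchanges the endpoints of [D t]. *)
have P1 := phi_diff _ _ l01 t01' e e0.
have P2 : \forall s \near 0,
    lo (- s \odot D t) - e * `|- s| <= phi l (t + - s) - phi l t
      <= hi (- s \odot D t) + e * `|- s|.
  by have := P1; rewrite -{1}oppr0 nearN.
have [t0 t1] : 0 < t /\ t < 1 by move: t01; rewrite in_itv => /andP.
near (0 : R)^'+ => s.
have s0 : 0 < s by near: s; exact: nbhs_right_gt.
have ts : s < t by near: s; exact: nbhs_right_lt.
have ts1 : s < 1 - t by near: s; apply: nbhs_right_lt; rewrite subr_gt0.
have /andP[l1 u1] : lo (s \odot D t) - e * `|s| <= phi l (t + s) - phi l t
    <= hi (s \odot D t) + e * `|s|.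
  by near: s; exact: (cvg_within _ P1).
have /andP[l2 u2] :
    lo (- s \odot D t) - e * `|- s| <= phi l (t + - s) - phi l t
      <= hi (- s \odot D t) + e * `|- s|.
  by near: s; exact: (cvg_within _ P2).
have ns0 : - s <= 0 by rewrite oppr_le0 ltW.
rewrite lo_scale_ge0 ?(ltW s0)// in l1; rewrite hi_scale_ge0 ?(ltW s0)// in u1.
rewrite lo_scale_le0// in l2; rewrite hi_scale_le0// in u2.
rewrite normrN in l2 u2; rewrite gtr0_norm// in l1 u1 l2 u2.
have k1 : k * (phi l (t + s) - y * (t + s)) <= k * (phi l t - y * t).
  by apply: kt; rewrite in_itv /=; lra.
have k2' : k * (phi l (t - s) - y * (t - s)) <= k * (phi l t - y * t).
  by apply: kt; rewrite in_itv /=; lra.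
(* At a maximum the right increment bounds [y] below and the left one bounds it above; at a minimum
   the roles are exchanged. *)
have [l3 u3] : s * (lo (D t) - e) <= s * y /\ s * y <= s * (hi (D t) + e).
  move/eqP: k2; rewrite sqrf_eq1 => /orP[]/eqP kE; rewrite {}kE in k1 k2'.
    by split; lra.
  by split; lra.
by rewrite -(ler_pM2l s0) l3 -(ler_pM2l s0).
Unshelve. all: by end_near. Qed.

Lemma Markov_mean_value y :
  y \in `[lo (G 1 \ominus_M G 0), hi (G 1 \ominus_M G 0)] ->
  exists2 t, t \in `[0, 1] & y \in `[lo (D t), hi (D t)].
Proof.
rewrite in_itv /=; set f := lo (G 1) - lo (G 0); set g := hi (G 1) - hi (G 0).
move=> yfg.
(* [l] is the weight that places [y] between the increments [f] and [g]; if these agree, any weight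
   would do. *)
have [l l01 ly] : exists2 l : R, 0 <= l <= 1 & y = l * f + (1 - l) * g.
  have [fg|gf|fg] := ltgtP f g.
  - exists ((g - y) / (g - f)); last by field; rewrite subr_eq0 gt_eqF.
    move: yfg; rewrite (min_idPl (ltW fg)) (max_idPr (ltW fg)) => /andP[fy yg].
    rewrite divr_ge0 ?subr_ge0 ?(ltW fg)//= ler_pdivrMr ?subr_gt0//.
    by rewrite mul1r; lra.
  - exists ((y - g) / (f - g)); last by field; rewrite subr_eq0 gt_eqF.
    move: yfg; rewrite (min_idPr (ltW gf)) (max_idPl (ltW gf)) => /andP[gy yf].
    rewrite divr_ge0 ?subr_ge0 ?(ltW gf)//= ler_pdivrMr ?subr_gt0//.
    by rewrite mul1r; lra.
  - exists 1; rewrite ?ler01 ?lexx// mul1r subrr mul0r addr0.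
    by move: yfg; rewrite -fg minxx maxxx => /le_anti.
pose psi t := phi l t - y * t.
have psi01 : psi 1 = psi 0 by rewrite /psi /phi ly /f /g; lra.
have psi_cont : {within `[0, 1], continuous psi}.
  apply: continuous_in_subspaceT => t /set_mem t01; apply: cvgB.
    exact: phi_cont.
  exact: mulrl_continuous.
have itvP (r : R) : r \in `[0, 1] -> [\/ r = 0, r = 1 | r \in `]0, 1[].
  rewrite !in_itv /= !le_eqVlt => /andP[/orP[/eqP<-|r0] /orP[/eqP|r1]].
  - by constructor 1.
  - by constructor 1.
  - by constructor 2.
  - by constructor 3; rewrite r0.
suff [t [k [t01 k2 kt]]] : exists t k, [/\ t \in `]0, 1[, k ^+ 2 = 1 &
    {in `[0, 1], forall r, k * psi r <= k * psi t}].
  exists t; first exact: subset_itv_oo_cc.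
  by rewrite in_itv; exact: interior_extremum kt.
have [c c01 cmax] := EVT_max ler01 psi_cont.
have [d d01 dmin] := EVT_min ler01 psi_cont.
have [c0|c0] : (c \in `]0, 1[) \/ (psi c = psi 0).
  by case: (itvP _ c01) => [->|->|?]; by [left|right].
  by exists c, 1; split; rewrite ?expr1n// => r /cmax; rewrite !mul1r.
have [d0|d0] : (d \in `]0, 1[) \/ (psi d = psi 0).
  by case: (itvP _ d01) => [->|->|?]; by [left|right].
  exists d, (-1); split; rewrite ?sqrrN ?expr1n// => r /dmin.
  by rewrite !mulN1r lerN2.
(* Both extrema equal the common value of [psi] at 0 and 1, so [psi] is constant on the segment and
   any interior point is a maximum. *)
exists (1 / 2), 1; split; rewrite ?expr1n ?in_itv//=; first lra.
move=> r r01; rewrite !mul1r (le_trans (cmax r r01))// c0 -d0 dmin//.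
by rewrite in_itv /=; lra.
Qed.

End mean_value.

(** * Differentiability along a line *)

Section line.
Context {R : realType} {n : nat}.
Implicit Types (F : 'rV[R]_n -> cinterval R) (x w : 'rV[R]_n).

Lemma enormZ (s : R) w : enorm (s *: w) = `|s| * enorm w.
Proof.
rewrite /enorm -sqrtr_sqr -sqrtrM ?sqr_ge0// mulr_sumr; congr Num.sqrt.
by apply: eq_bigr => i _; rewrite mxE exprMn.
Qed.

Lemma Mdifferentiable_line F x w : Mdifferentiable_at F x ->
  forall e, 0 < e -> \forall s \near (0 : R),
    ci_dist (F (x + s *: w) \ominus_M F x)
      (s \odot \sum_(i < n) w 0 i \odot Mpartial F x i) <= e * `|s|.
Proof.
move=> [_ [E [E0 [d d0 Fd]]]] e e0.
have w0 : 0 <= enorm w by exact: sqrtr_ge0.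
(* Adding 1 keeps the divisor positive when [w = 0]. *)
have w1 : 0 < 1 + enorm w by rewrite ltr_pwDl.
have e'0 : 0 < e / (1 + enorm w) by rewrite divr_gt0.
have sw : (s *: w : 'rV[R]_n) @[s --> (0 : R)] --> (0 : 'rV[R]_n).
  by rewrite -[X in _ --> X](scale0r w); apply: cvgZr_tmp; exact: cvg_id.
have Ee : \forall h \near (0 : 'rV[R]_n),
    h != 0 -> ball (0 : cinterval R) (e / (1 + enorm w)) (E h).
  exact: (E0 _ (nbhsx_ballx _ _ e'0)).
near=> s.
have sd : enorm (s *: w) < d.
  rewrite enormZ (@le_lt_trans _ _ (`|s| * (1 + enorm w)))//.
    by rewrite ler_wpM2l// lerDr.
  rewrite -ltr_pdivlMr//; near: s; exact: (@nbhs0_lt R R _ (divr_gt0 d0 w1)).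
have -> : s \odot (\sum_(i < n) w 0 i \odot Mpartial F x i) =
    \sum_(i < n) (s *: w) 0 i \odot Mpartial F x i.
  by rewrite ci_scale_sumr; apply: eq_bigr => i _; rewrite ci_scaleA mxE.
rewrite Fd// ci_distDl.
(* The limit of [E] is punctured and says nothing about [E 0], but there the factor [enorm 0]
   cancels the error term. *)
have [->|sw0] := eqVneq (s *: w) 0.
  have -> : enorm (0 : 'rV[R]_n) = 0.
    by rewrite -(scale0r w) enormZ normr0 mul0r.
  by rewrite ci_scale0r ci_distxx mulr_ge0// ltW.
have : ball (0 : cinterval R) (e / (1 + enorm w)) (E (s *: w)).
  by move: sw0; near: s; exact: (sw _ Ee).
rewrite cinterval_ballE /= ci_dist_sym => Es.
rewrite ci_dist_scale0 ?sqrtr_ge0// enormZ -mulrA [leRHS]mulrC ler_wpM2l//.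
rewrite (@le_trans _ _ (enorm w * (e / (1 + enorm w))))//.
  by rewrite ler_wpM2l// ltW.
by rewrite mulrCA ler_piMr ?(ltW e0)// ler_pdivrMr// mul1r lerDr.
Unshelve. all: by end_near. Qed.

End line.

Theorem theorem3p1 (R : realType) (n : nat) (Omega : set 'rV[R]_n)
    (F : 'rV[R]_n -> cinterval R)
    (Omega_open : open Omega) (Omega_convex : convex_set Omega)
    (F_diff : Mdifferentiable_on Omega F)
    (u v : 'rV[R]_n) (u_in : Omega u) (v_in : Omega v) :
  ciset (F v \ominus_M F u) `<=`
    \bigcup_(c in line_seg u v)
      ciset (\sum_(i < n) (v 0 i - u 0 i) \odot Mpartial F c i).
Proof.
have seg t : t \in `[0, 1] -> Omega (u + t *: (v - u)).
  rewrite in_itv /= => /andP[t0 t1].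
  (* The weight [t] goes to [v], which gives [t v + (1 - t) u = u + t (v - u)]. *)
  have := @Omega_convex v u (Itv01 t0 t1) (mem_set v_in) (mem_set u_in).
  rewrite inE; congr Omega; rewrite /conv /=.
  by rewrite scalerBr scalerBl scale1r addrCA addrC.
pose G t := F (u + t *: (v - u)).
pose D t := \sum_(i < n) (v 0 i - u 0 i) \odot Mpartial F (u + t *: (v - u)) i.
(* Moving the parameter from [t] to [t + s] displaces the point by [s (v - u)], so this is the
   expansion of [F] at [u + t (v - u)] in direction [v - u]. *)
have GD t : t \in `[0, 1] -> forall e : R, 0 < e -> \forall s \near 0,
    ci_dist (G (t + s) \ominus_M G t) (s \odot D t) <= e * `|s|.
  move=> /seg/F_diff/(@Mdifferentiable_line _ _ _ _ (v - u)) Fl e /Fl.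
  apply: filterS => s; rewrite /G /D scalerDl addrA.
  by under eq_bigr do rewrite !mxE.
move=> y /=; have -> : F v = G 1 by rewrite /G scale1r addrC subrK.
have -> : F u = G 0 by rewrite /G scale0r addr0.
move=> /(Markov_mean_value _ _ GD)[t t01 yt].
by exists (u + t *: (v - u)) => //; exists t.
Qed.
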